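(* Let $f:\mathbb{R}^n\to\mathbb{R}$ be twice differentiable and bounded below, and suppose that $\|\nabla^2 f(x)-\nabla^2 f(y)\|\le M\|x-y\|$ for all $x,y\in\mathbb{R}^n$, where $M>0$. Let $\{x_k\}$ be the sequence generated by the universal trust-region method with the simple strategy, and assume that $x_k\to x^*$ as $k\to+\infty$, where $\nabla f(x^* )=0$ and $\nabla^2 f(x^* )\succeq\mu I$ for some $\mu>0$. Then $\{x_k\}$ converges to $x^*$ superlinearly, i.e. there is a sequence $c_k\to0$ with $\|x_{k+1}-x^*\|\le c_k\|x_k-x^*\|$ for all sufficiently large $k$.
   Context: Norms are the Euclidean norm for vectors and the induced operator norm for matrices. The universal trust-region method with the simple strategy starts at some $x_0\in\mathbb{R}^n$ and generates $x_{k+1}=x_k+d_k$, $k=0,1,2,\dots$, where $d_k$ is a (global) solution of $$\min_{d\in\mathbb{R}^n}\ \tfrac12 d^T\left(\nabla^2 f(x_k)+\sigma_k\|\nabla f(x_k)\|^{1/2}I\right)d+\nabla f(x_k)^Td\quad\text{s.t. }\|d\|\le r_k\|\nabla f(x_k)\|^{1/2},$$ with $(\sigma_k,r_k)=\left(\frac{\sqrt M}{3},\frac1{3\sqrt M}\right)$ for all $k$. *)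

(* Defs.v *)
From mathcomp Require Import all_boot all_order all_algebra.
From mathcomp Require Import all_classical all_reals all_analysis.
Import Order.TTheory GRing.Theory Num.Theory.
Import numFieldNormedType.Exports.

Set Implicit Arguments.
Unset Strict Implicit.
Unset Printing Implicit Defensive.

Local Open Scope classical_set_scope.
Local Open Scope ring_scope.

(* Vectors of R^n are row vectors and a matrix A acts on them by v |-> v *m A,
   the convention under which the library's 'J g x represents the differential
   of g at x. *)

Definition dotv (R : realType) (n : nat) (u v : 'rV[R]_n) : R :=
  \sum_i u 0 i * v 0 i.

(* The library norm `|v| on 'rV[R]_n is the sup norm, hence this definition. *)
Definition enorm (R : realType) (n : nat) (v : 'rV[R]_n) : R :=
  Num.sqrt (dotv v v).

(* The set is nonempty and bounded above, so sup is its least upper bound. *)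
Definition opnorm (R : realType) (n : nat) (A : 'M[R]_n) : R :=
  sup [set enorm (v *m A) | v in [set v : 'rV[R]_n | enorm v <= 1]].

Definition psdmx (R : realType) (n : nat) (A : 'M[R]_n) : Prop :=
  forall v : 'rV[R]_n, 0 <= dotv (v *m A) v.

Definition grad (R : realType) (n : nat) (f : 'rV[R]_n -> R) (x : 'rV[R]_n) :
    'rV[R]_n :=
  \row_i 'D_(delta_mx 0 i) f x.

Definition hess (R : realType) (n : nat) (f : 'rV[R]_n -> R) (x : 'rV[R]_n) :
    'M[R]_n :=
  'J (grad f) x.

Definition twice_differentiable (R : realType) (n : nat)
    (f : 'rV[R]_n -> R) : Prop :=
  (forall x, differentiable f x) /\ (forall x, differentiable (grad f) x).

Definition utr_model (R : realType) (n : nat) (f : 'rV[R]_n -> R) (sigma : R)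
    (x d : 'rV[R]_n) : R :=
  2^-1 * dotv (d *m (hess f x + (sigma * Num.sqrt (enorm (grad f x)))%:M)) d
  + dotv (grad f x) d.

Definition utr_subproblem_solution (R : realType) (n : nat)
    (f : 'rV[R]_n -> R) (sigma r : R) (x d : 'rV[R]_n) : Prop :=
  enorm d <= r * Num.sqrt (enorm (grad f x)) /\
  forall d' : 'rV[R]_n, enorm d' <= r * Num.sqrt (enorm (grad f x)) ->
    utr_model f sigma x d <= utr_model f sigma x d'.

Definition utr_sequence (R : realType) (n : nat) (f : 'rV[R]_n -> R)
    (sigma r : nat -> R) (x : nat -> 'rV[R]_n) : Prop :=
  exists d : nat -> 'rV[R]_n, forall k,
    utr_subproblem_solution f (sigma k) (r k) (x k) (d k) /\
    x k.+1 = x k + d k.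

Definition simple_utr_sequence (R : realType) (n : nat) (f : 'rV[R]_n -> R)
    (M : R) (x : nat -> 'rV[R]_n) : Prop :=
  utr_sequence f (fun=> Num.sqrt M / 3) (fun=> 1 / (3 * Num.sqrt M)) x.

Definition superlinear_cvg (R : realType) (n : nat) (x : nat -> 'rV[R]_n)
    (xs : 'rV[R]_n) : Prop :=
  exists c : nat -> R, c @ \oo --> (0 : R) /\
    \forall k \near \oo, enorm (x k.+1 - xs) <= c k * enorm (x k - xs).

(* Main.v *)
Require Import Defs.
From mathcomp Require Import all_boot all_order all_algebra.
From mathcomp Require Import all_classical all_reals all_analysis.
From mathcomp Require Import ring lra.
Import Order.TTheory GRing.Theory Num.Theory.
Import numFieldNormedType.Exports.

(** Superlinear convergence is read off from function values.  Write
    e_k = x_k - xs, g_k = grad f (x_k) and s_k = sigma * sqrt |g_k|, the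
    vanishing regularization weight.  A Lipschitz Hessian makes f agree with
    its quadratic expansion at any point up to M |d|^3 ([taylor2]).

    The point xs itself is eventually a competitor in the subproblem at x_k:
    |g_k| grows at least linearly in |e_k| ([grad_growth]), so the trust-region
    radius r * sqrt |g_k| is of order at least sqrt |e_k| and exceeds |e_k|.
    Minimality of d_k against xs - x_k, with both model values traded for
    values of f, gives ([utr_step_decrease])

      f (x_{k+1}) - f xs <= s_k / 2 |e_k|^2 + M |d_k|^3 + M |e_k|^3,

    whereas f (x_{k+1}) - f xs >= mu / 2 |e_{k+1}|^2 - M |e_{k+1}|^3
    ([quadratic_growth]).  As |d_k| <= |e_k| + |e_{k+1}|, the cubic terms are
    o(1) (|e_k|^2 + |e_{k+1}|^2), and the part in |e_{k+1}|^2 is absorbed on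
    the left.  What remains is |e_{k+1}|^2 <= c_k^2 |e_k|^2 with an explicit
    c_k that tends to 0 ([utr_step_error]).

    The stationarity equation of the subproblem would involve the symmetric part
    of the Hessian and a multiplier for the trust-region constraint; comparing
    values of f brings in the Hessian only through its quadratic form. *)

Set Implicit Arguments.
Unset Strict Implicit.
Unset Printing Implicit Defensive.

Local Open Scope classical_set_scope.
Local Open Scope ring_scope.

(** * Euclidean norm and operator norm *)

Section Euclid.
Context {R : realType} {n : nat}.
Implicit Types (u v w : 'rV[R]_n) (A : 'M[R]_n).

Lemma dotvC u v : dotv u v = dotv v u.
Proof. by apply: eq_bigr => i _; rewrite mulrC. Qed.

Lemma dotvDl u v w : dotv (u + v) w = dotv u w + dotv v w.
Proof. by rewrite -big_split; apply: eq_bigr => i _; rewrite mxE mulrDl. Qed.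

Lemma dotvZl a u v : dotv (a *: u) v = a * dotv u v.
Proof. by rewrite mulr_sumr; apply: eq_bigr => i _; rewrite mxE mulrA. Qed.

Lemma dotvNl u v : dotv (- u) v = - dotv u v.
Proof. by rewrite -scaleN1r dotvZl mulN1r. Qed.

Lemma dotvDr u v w : dotv u (v + w) = dotv u v + dotv u w.
Proof. by rewrite dotvC dotvDl ![dotv _ u]dotvC. Qed.

Lemma dotvZr a u v : dotv u (a *: v) = a * dotv u v.
Proof. by rewrite dotvC dotvZl dotvC. Qed.

Lemma dotvNr u v : dotv u (- v) = - dotv u v.
Proof. by rewrite dotvC dotvNl dotvC. Qed.

Lemma dotv_ge0 u : 0 <= dotv u u.
Proof. by apply: sumr_ge0 => i _; rewrite -expr2 sqr_ge0. Qed.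

Lemma enorm_ge0 u : 0 <= enorm u.
Proof. exact: sqrtr_ge0. Qed.

Lemma enorm_sqr u : enorm u ^+ 2 = dotv u u.
Proof. by rewrite sqr_sqrtr ?dotv_ge0. Qed.

Lemma enormN u : enorm (- u) = enorm u.
Proof. by rewrite /enorm dotvNl dotvNr opprK. Qed.

Lemma enormZ a u : enorm (a *: u) = `|a| * enorm u.
Proof.
by rewrite /enorm dotvZl dotvZr mulrA -expr2 sqrtrM ?sqr_ge0// sqrtr_sqr.
Qed.

Lemma coord_le_enorm u i : `|u 0 i| <= enorm u.
Proof.
rewrite -sqrtr_sqr ler_wsqrtr// /dotv (bigD1 i)//= -expr2 lerDl.
by apply: sumr_ge0 => j _; rewrite -expr2 sqr_ge0.
Qed.

Lemma enorm_eq0 u : enorm u = 0 -> u = 0.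
Proof.
move=> u0; apply/rowP => i; apply/eqP.
by rewrite mxE -normr_le0 -u0 coord_le_enorm.
Qed.

(** Cauchy-Schwarz: expand the square of |v| u - |u| v, which is nonnegative. *)
Lemma dotv_le u v : dotv u v <= enorm u * enorm v.
Proof.
have [/enorm_eq0 ->|u0] := eqVneq (enorm u) 0.
  by rewrite -(scale0r 0) dotvZl enormZ normr0 !mul0r.
have [/enorm_eq0 ->|v0] := eqVneq (enorm v) 0.
  by rewrite -(scale0r 0) dotvZr enormZ normr0 !mul0r mulr0.
have := dotv_ge0 (enorm v *: u - enorm u *: v).
rewrite !(dotvDl, dotvDr, dotvNl, dotvNr, dotvZl, dotvZr) -!enorm_sqr.
rewrite [dotv v u]dotvC => h.
have uv0 : 0 < enorm u * enorm v.
  by rewrite mulr_gt0 ?lt_def ?u0 ?v0 ?enorm_ge0.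
rewrite -(ler_pM2l uv0); nra.
Qed.

Lemma dotv_normr_le u v : `|dotv u v| <= enorm u * enorm v.
Proof.
rewrite ler_norml dotv_le andbT lerNl -dotvNl.
by rewrite (le_trans (dotv_le _ _))// enormN.
Qed.

Lemma enormD u v : enorm (u + v) <= enorm u + enorm v.
Proof.
rewrite -(ler_pXn2r (ltn0Sn 1)) ?nnegrE ?addr_ge0 ?enorm_ge0//.
rewrite enorm_sqr dotvDl !dotvDr -!enorm_sqr [dotv v u]dotvC.
have := dotv_le u v; nra.
Qed.

Lemma enorm_sum m (F : 'I_m -> 'rV[R]_n) :
  enorm (\sum_i F i) <= \sum_i enorm (F i).
Proof.
elim/big_ind2 : _ => // [|a b c d ab cd].
  by rewrite -(scale0r 0) enormZ normr0 mul0r.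
by rewrite (le_trans (enormD _ _))// lerD.
Qed.

(** The supremum defining [opnorm] only bounds its elements once the set is
    known to be bounded; the sum of the norms of the rows is a crude bound. *)
Lemma opnorm_le A u : enorm (u *m A) <= opnorm A * enorm u.
Proof.
have bnd : has_ubound
    [set enorm (v *m A) | v in [set v : 'rV[R]_n | enorm v <= 1]].
  exists (\sum_i enorm (row i A)) => _ [v /= v1 <-].
  rewrite mulmx_sum_row (le_trans (enorm_sum _))//; apply: ler_sum => i _.
  rewrite enormZ ler_piMl ?enorm_ge0//.
  exact: le_trans (coord_le_enorm _ _) v1.
have [/enorm_eq0 ->|u0] := eqVneq (enorm u) 0.
  by rewrite mul0mx -(scale0r 0) enormZ normr0 !mul0r mulr0.
have u_gt0 : 0 < enorm u by rewrite lt_def u0 enorm_ge0.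
rewrite -ler_pdivrMr// mulrC.
have -> : (enorm u)^-1 * enorm (u *m A) = enorm (((enorm u)^-1 *: u) *m A).
  by rewrite -scalemxAl enormZ ger0_norm ?invr_ge0 ?enorm_ge0.
apply: ub_le_sup => //; exists ((enorm u)^-1 *: u) => //=.
by rewrite enormZ ger0_norm ?invr_ge0 ?enorm_ge0// mulVf.
Qed.

Lemma quad_form_le A u : `|dotv (u *m A) u| <= opnorm A * enorm u ^+ 2.
Proof.
rewrite (le_trans (dotv_normr_le _ _))// expr2 mulrA.
by rewrite ler_wpM2r ?enorm_ge0 ?opnorm_le.
Qed.

Lemma psdmx_scalar_le A (mu : R) u : psdmx (A - mu%:M) ->
  mu * enorm u ^+ 2 <= dotv (u *m A) u.
Proof.
by move=> /(_ u); rewrite mulmxBr mul_mx_scalar dotvDl dotvNl dotvZl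
  enorm_sqr subr_ge0.
Qed.

End Euclid.

(** * Second-order Taylor expansion *)

Section Taylor.
Context {R : realType} {n : nat}.
Implicit Types (f : 'rV[R]_n -> R) (x d u : 'rV[R]_n).

(** The difference quotients of s |-> F (x + s d) at t are literally those of F
    at x + t d in the direction d. *)
Lemma is_derive_along_line (W : normedModType R) (F : 'rV[R]_n -> W) x d
    (t : R) :
  differentiable F (x + t *: d) ->
  is_derive t 1 (fun s => F (x + s *: d)) ('D_d F (x + t *: d)).
Proof.
move=> dF; have := derivableP (diff_derivable (v := d) dF); case.
have E : (fun h : R => h^-1 *: ((F \o shift (x + t *: d)) (h *: d)
                                 - F (x + t *: d))) =
         (fun h : R => h^-1 *: (((fun s => F (x + s *: d)) \o shift t)
                                  (h *: (1 : R)) - F (x + t *: d))).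
  apply/funext => h /=; congr (_ *: (F _ - _)).
  by rewrite scalerDl [h%:A]mulr1 addrCA.
by rewrite /derivable /derive E => h1 h2; split.
Qed.

Lemma derive_grad f x d : differentiable f x -> 'D_d f x = dotv (grad f x) d.
Proof.
move=> df; rewrite deriveE// {1}(row_sum_delta d) linear_sum.
by apply: eq_bigr => i _; rewrite linearZ mxE deriveE// mulrC.
Qed.

Lemma is_derive_dotv (g : R -> 'rV[R]_n) dg (t : R) u :
  is_derive t 1 g dg -> is_derive t 1 (fun s => dotv (g s) u) (dotv dg u).
Proof.
case=> dgt <-; rewrite derive_mx//.
have := (derivable_mxP g t 1).1 dgt => dgi.
have -> : (fun s => dotv (g s) u) = \sum_i (u 0 i \*: (fun s => g s 0 i)).
  apply/funext => s; rewrite fct_sumE; apply: eq_bigr => i _.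
  by rewrite mulrC.
apply: is_derive_eq.
  by apply: is_derive_sum => i; apply: is_deriveZ; exact: derivableP.
by apply: eq_bigr => i _; rewrite mxE mulrC.
Qed.

Lemma MVT01 (h dh : R -> R) (C : R) :
  (forall t : R, is_derive t 1 h (dh t)) ->
  (forall t, 0 <= t <= 1 -> `|dh t| <= C) ->
  forall t, 0 <= t <= 1 -> `|h t - h 0| <= C.
Proof.
move=> hd hC t /andP[t0 t1].
have C0 : 0 <= C by rewrite (le_trans _ (hC 0 _)) ?lexx ?ler01.
have [|c + ->] := @MVT_segment R h dh 0 t t0 (fun s _ => hd s).
  by apply: derivable_within_continuous => s _; exact: ex_derive.
rewrite in_itv/= => /andP[c0 ct].
rewrite subr0 normrM (ger0_norm t0).
rewrite (le_trans (ler_wpM2r t0 (hC c _))) ?c0 ?(le_trans ct)//.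
by rewrite ler_piMr.
Qed.

(** Two applications of the mean value theorem to the remainder of
    s |-> f (x + s d), whose second derivative is the increment of the quadratic
    form of the Hessian, at most M |d|^3.  Integrating twice would give the
    constant M / 6; any multiple of M serves the convergence proof. *)
Lemma taylor2 f (M : R) x d :
  0 <= M -> twice_differentiable f ->
  (forall y z, opnorm (hess f y - hess f z) <= M * enorm (y - z)) ->
  `|f (x + d) - f x - dotv (grad f x) d - 2^-1 * dotv (d *m hess f x) d|
    <= M * enorm d ^+ 3.
Proof.
move=> M0 [df dgrad] lip.
have d1 (t : R) : is_derive t 1 (fun s => f (x + s *: d))
    (dotv (grad f (x + t *: d)) d).
  by rewrite -derive_grad//; exact: is_derive_along_line.
have d2 (t : R) : is_derive t 1 (fun s => dotv (grad f (x + s *: d)) d)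
    (dotv (d *m hess f (x + t *: d)) d).
  have <- : 'D_d (grad f) (x + t *: d) = d *m hess f (x + t *: d).
    exact: deriveEjacobian.
  have := is_derive_along_line (dgrad (x + t *: d)).
  exact: is_derive_dotv.
set a := dotv (grad f x) d; set b := dotv (d *m hess f x) d.
have D1 (t : R) : is_derive t 1 (fun s => dotv (grad f (x + s *: d)) d - b * s)
    (dotv (d *m hess f (x + t *: d)) d - b).
  have -> : dotv (d *m hess f (x + t *: d)) d - b
      = dotv (d *m hess f (x + t *: d)) d - b *: (1 : R).
    by rewrite [b *: 1]mulr1.
  by apply: is_deriveB; apply: is_deriveZ.
pose h s := f (x + s *: d) - a * s - 2^-1 * b * s ^+ 2.
have D0 (t : R) : is_derive t 1 h (dotv (grad f (x + t *: d)) d - b * t - a).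
  have -> : dotv (grad f (x + t *: d)) d - b * t - a
      = dotv (grad f (x + t *: d)) d - a *: (1 : R)
        - (2^-1 * b) *: (t *: (1 : R) + t *: (1 : R)).
    by rewrite /GRing.scale /= !mulr1; field.
  exact: is_deriveB.
have x0 : x + 0 *: d = x by rewrite scale0r addr0.
have x1 : x + 1 *: d = x + d by rewrite scale1r.
have t0 : 0 <= (0 : R) <= 1 by rewrite lexx ler01.
have t1 : 0 <= (1 : R) <= 1 by rewrite lexx ler01.
have b1 t : 0 <= t <= 1 ->
    `|dotv (grad f (x + t *: d)) d - b * t - a| <= M * enorm d ^+ 3.
  move=> t01.
  have -> : a = dotv (grad f (x + 0 *: d)) d - b * 0 by rewrite mulr0 subr0 x0.
  apply: (MVT01 D1) t01 => {}t /andP[t_ge0 t_le1].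
  have -> : dotv (d *m hess f (x + t *: d)) d - b
      = dotv (d *m (hess f (x + t *: d) - hess f x)) d.
    by rewrite mulmxBr dotvDl dotvNl.
  rewrite (le_trans (quad_form_le _ _))// [_ ^+ 3]exprS mulrA.
  rewrite ler_wpM2r ?exprn_ge0 ?enorm_ge0// (le_trans (lip _ _))// ler_wpM2l//.
  by rewrite addrAC subrr add0r enormZ ger0_norm// ler_piMl ?enorm_ge0.
have := MVT01 D0 b1 t1; rewrite /h x0 x1.
by congr (`|_| <= _); ring.
Qed.
End Taylor.

(** * Behaviour near a nondegenerate minimizer *)

Section LocalGeometry.
Context {R : realType} {n : nat} (f : 'rV[R]_n -> R) (M mu : R).
Context (f_diff2 : twice_differentiable f) (M_gt0 : 0 < M).
Context (hess_lipschitz : forall y z : 'rV[R]_n,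
  opnorm (hess f y - hess f z) <= M * enorm (y - z)).
Context (xs : 'rV[R]_n) (grad_xs : grad f xs = 0).
Context (hess_xs : psdmx (hess f xs - mu%:M)).

Lemma quadratic_growth y :
  mu / 2 * enorm (y - xs) ^+ 2 - M * enorm (y - xs) ^+ 3 <= f y - f xs.
Proof.
have := taylor2 xs (y - xs) (ltW M_gt0) f_diff2 hess_lipschitz.
rewrite subrKC grad_xs -(scale0r 0) dotvZl mul0r subr0 ler_norml => /andP[lb _].
have := psdmx_scalar_le (y - xs) hess_xs; lra.
Qed.

(** Obtained by Cauchy-Schwarz from a lower bound on the inner product of the
    gradient with e = y - xs: the expansion of f at y, evaluated at xs, bounds
    it below by f y - f xs plus half the quadratic form of the Hessian at y, and
    each of these contributes mu / 2 |e|^2 up to a cubic error.  The errors add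
    up to 5 / 2 M |e|^3, whence the smallness condition. *)
Lemma grad_growth y : 5 * M * enorm (y - xs) <= mu ->
  mu / 2 * enorm (y - xs) <= enorm (grad f y).
Proof.
have growth := quadratic_growth y.
have lip := hess_lipschitz y xs.
have := taylor2 y (- (y - xs)) (ltW M_gt0) f_diff2 hess_lipschitz.
rewrite subKr; move: growth lip hess_xs.
(* Only the closeness of the Hessians at y and at xs matters from here on, so the
   Hessian is replaced by an arbitrary matrix field H. *)
move: (y - xs) (hess f) => e H growth lip psdH.
rewrite mulNmx !(dotvNr, dotvNl) !opprK enormN ler_norml.
move=> /andP[back _] small.
have [->|e0] := eqVneq (enorm e) 0; first by rewrite mulr0 enorm_ge0.
have e_gt0 : 0 < enorm e by rewrite lt_def e0 enorm_ge0.
rewrite -(ler_pM2r e_gt0).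
have grad_e := dotv_le (grad f y) e.
have psd := psdmx_scalar_le e psdH.
have : `|dotv (e *m (H y - H xs)) e| <= M * enorm e ^+ 3.
  rewrite (le_trans (quad_form_le _ _))// [_ ^+ 3]exprS mulrA.
  by rewrite ler_wpM2r ?sqr_ge0.
rewrite ler_norml mulmxBr dotvDl dotvNl => /andP[diff _].
have small3 : 5 * M * enorm e ^+ 3 <= mu * enorm e ^+ 2.
  by rewrite [_ ^+ 3]exprS mulrA ler_wpM2r ?sqr_ge0.
lra.
Qed.

(** The competitor xs - x turns minimality of d into an upper bound on
    f (x + d): each model value is a value of f up to a cubic Taylor error, and
    the regularization term at d is dropped because it is nonnegative. *)
Lemma utr_step_decrease (sigma r : R) x d : 0 <= sigma ->
  utr_subproblem_solution f sigma r x d ->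
  enorm (xs - x) <= r * Num.sqrt (enorm (grad f x)) ->
  f (x + d) - f xs <=
    2^-1 * (sigma * Num.sqrt (enorm (grad f x))) * enorm (x - xs) ^+ 2
    + M * enorm d ^+ 3 + M * enorm (x - xs) ^+ 3.
Proof.
move=> sigma0 [_ opt] /opt.
rewrite /utr_model !mulmxDr !mul_mx_scalar !dotvDl !dotvZl.
rewrite -!enorm_sqr -[xs - x]opprB enormN => opt_xs.
have := taylor2 x d (ltW M_gt0) f_diff2 hess_lipschitz.
rewrite ler_norml => /andP[_ at_d].
have := taylor2 x (- (x - xs)) (ltW M_gt0) f_diff2 hess_lipschitz.
rewrite enormN subKr ler_norml => /andP[at_xs _].
have : 0 <= sigma * Num.sqrt (enorm (grad f x)) * enorm d ^+ 2.
  by rewrite !mulr_ge0 ?sqr_ge0 ?sqrtr_ge0.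
lra.
Qed.

(** The two smallness conditions let the cubic terms take up at most half of
    the quadratic growth mu / 2 |x + d - xs|^2: a quarter through
    |x + d - xs|^3, and a quarter through the share of |d|^3 that falls on
    |x + d - xs|^2.  The factor 4 / mu inverts the mu / 4 that is left. *)
Lemma utr_step_error (sigma r : R) x d : 0 <= sigma -> 0 < mu ->
  utr_subproblem_solution f sigma r x d ->
  enorm (xs - x) <= r * Num.sqrt (enorm (grad f x)) ->
  16 * M * enorm d <= mu -> 8 * M * enorm (x + d - xs) <= mu ->
  enorm (x + d - xs) <= Num.sqrt (4 / mu *
    (2^-1 * (sigma * Num.sqrt (enorm (grad f x))) + 2 * M * enorm d
     + M * enorm (x - xs))) * enorm (x - xs).
Proof.
move=> sigma0 mu0 sol feas small_d small_e.
have step := utr_step_decrease sigma0 sol feas.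
have growth := quadratic_growth (x + d).
have d_le : enorm d <= enorm (x + d - xs) + enorm (x - xs).
  have -> : enorm d = enorm (x + d - xs - (x - xs)).
    by rewrite opprB addrA subrK [x + d - x]addrC addKr.
  by rewrite (le_trans (enormD _ _))// enormN.
move: growth step small_d small_e d_le.
set s := sigma * _; have s0 : 0 <= s by rewrite mulr_ge0 ?sqrtr_ge0.
have := enorm_ge0 d; have := enorm_ge0 (x + d - xs).
have := enorm_ge0 (x - xs).
set a := enorm (x + d - xs); set b := enorm (x - xs); set D := enorm d.
clearbody s a b D; move=> b0 a0 D0 growth step small_d small_a D_le.
set K := 2^-1 * s + 2 * M * D + M * b.
have K0 : 0 <= K by rewrite !addr_ge0 ?mulr_ge0 ?invr_ge0// ltW.
(* D^2 <= (a + b)^2 <= 2 (a^2 + b^2); one factor D is kept since it tends to 0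
   along the sequence. *)
have cube_d : M * D ^+ 3 <= 2 * M * D * (a ^+ 2 + b ^+ 2).
  have D2 : D ^+ 2 <= 2 * (a ^+ 2 + b ^+ 2).
    have : D ^+ 2 <= (a + b) ^+ 2 by rewrite ler_pXn2r ?nnegrE ?addr_ge0.
    by have := sqr_ge0 (a - b); lra.
  have -> : M * D ^+ 3 = M * D * D ^+ 2 by ring.
  have -> : 2 * M * D * (a ^+ 2 + b ^+ 2) = M * D * (2 * (a ^+ 2 + b ^+ 2)).
    by ring.
  by rewrite ler_wpM2l// mulr_ge0// ltW.
have absorb_d : 16 * M * D * a ^+ 2 <= mu * a ^+ 2.
  by rewrite ler_wpM2r ?sqr_ge0.
have absorb_a : 8 * M * a ^+ 3 <= mu * a ^+ 2.
  by rewrite [a ^+ 3]exprS mulrA ler_wpM2r ?sqr_ge0.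
have key : mu / 4 * a ^+ 2 <= K * b ^+ 2 by rewrite /K; lra.
rewrite -(ler_pXn2r (ltn0Sn 1)) ?nnegrE ?mulr_ge0 ?sqrtr_ge0//.
rewrite exprMn sqr_sqrtr ?mulr_ge0 ?invr_ge0 ?(ltW mu0)//.
rewrite -(ler_pM2l (divr_gt0 mu0 (ltr0n R 4))) (le_trans key)//.
have -> : mu / 4 * (4 / mu * K * b ^+ 2) = K * b ^+ 2 by field; rewrite gt_eqF.
by [].
Qed.
End LocalGeometry.

(** * Limits in the Euclidean norm *)

Section Limits.
Context {R : realType}.

(** Convergence of vectors refers to the sup norm; this comparison transfers it
    to [enorm]. *)
Lemma enorm_le_sup n (u : 'rV[R]_n) : enorm u <= Num.sqrt n%:R * `|u|.
Proof.
rewrite -[`|u|]ger0_norm// -sqrtr_sqr -sqrtrM// ler_wsqrtr//.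
rewrite -[n in n%:R]card_ord mulr_natl -sumr_const; apply: ler_sum => i _.
have ui : `|u 0 i| <= `|u|.
  rewrite [leRHS]/Num.norm /= mx_normrE.
  exact: (le_bigmax _ (fun ij : 'I_1 * 'I_n => `|u ij.1 ij.2|) (0, i)).
by rewrite -expr2 -real_normK ?num_real// ler_pXn2r ?nnegrE.
Qed.

Lemma cvg_enorm0 n (u : nat -> 'rV[R]_n) :
  u @ \oo --> (0 : 'rV[R]_n) -> enorm (u k) @[k --> \oo] --> (0 : R).
Proof.
move=> u0.
apply: (@squeeze_cvgr _ _ _ _ (fun=> 0) (fun k => Num.sqrt n%:R * `|u k|)).
- by near=> k; rewrite enorm_ge0 enorm_le_sup.
- exact: cvg_cst.
- rewrite -(mulr0 (Num.sqrt n%:R)); apply: cvgMr; rewrite -(normr0 'rV[R]_n).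
  exact: cvg_norm.
Unshelve. all: by end_near. Qed.

Lemma cvg_near_mul_le (u : nat -> R) (C b : R) : u @ \oo --> (0 : R) ->
  0 < b -> \forall k \near \oo, C * u k <= b.
Proof.
move=> u0 b0.
have : C * u k @[k --> \oo] --> (0 : R).
  by rewrite -(mulr0 C); apply: cvgMr.
by move=> /cvgr_lt /(_ _ b0); apply: filterS => k /ltW.
Qed.

Lemma cvg_sqrt0 (u : nat -> R) : u @ \oo --> (0 : R) ->
  Num.sqrt (u k) @[k --> \oo] --> (0 : R).
Proof.
move=> u0.
have : Num.sqrt (u k) @[k --> \oo] --> (Num.sqrt 0 : R).
  by apply: continuous_cvg u0; exact: sqrt_continuous.
by rewrite sqrtr0.
Qed.
End Limits.

(** * Superlinear convergence *)

Unset Implicit Arguments.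

Theorem theorem3p3 (R : realType) (n : nat) (f : 'rV[R]_n -> R) (M mu : R)
    (x : nat -> 'rV[R]_n) (xs : 'rV[R]_n)
    (f_diff2 : twice_differentiable f)
    (f_bounded_below : has_lbound (range f))
    (M_gt0 : 0 < M)
    (hess_lipschitz : forall y z : 'rV[R]_n,
      opnorm (hess f y - hess f z) <= M * enorm (y - z))
    (x_utr : simple_utr_sequence f M x)
    (x_cvg : x @ \oo --> xs)
    (grad_xs : grad f xs = 0)
    (mu_gt0 : 0 < mu)
    (hess_xs : psdmx (hess f xs - mu%:M)) :
  superlinear_cvg x xs.
Proof.
have [d dP] := x_utr.
set sigma := Num.sqrt M / 3 in dP; set r := 1 / _ in dP.
have sqM0 : 0 < Num.sqrt M by rewrite sqrtr_gt0.
have sigma0 : 0 <= sigma by rewrite divr_ge0// ltW.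
have r0 : 0 < r by rewrite divr_gt0// mulr_gt0.
have x1_cvg : x k.+1 @[k --> \oo] --> xs by rewrite cvg_shiftS.
have e0 : enorm (x k - xs) @[k --> \oo] --> (0 : R).
  by apply: cvg_enorm0; rewrite -(subrr xs); apply: cvgB => //; exact: cvg_cst.
have e1 : enorm (x k.+1 - xs) @[k --> \oo] --> (0 : R).
  by apply: cvg_enorm0; rewrite -(subrr xs); apply: cvgB => //; exact: cvg_cst.
have d0 : enorm (d k) @[k --> \oo] --> (0 : R).
  apply: cvg_enorm0.
  have -> : d = (fun k => x k.+1 - x k).
    by apply/funext => k; have [_ ->] := dP k; rewrite addrC addKr.
  by rewrite -(subrr xs); apply: cvgB.
have g0 : enorm (grad f (x k)) @[k --> \oo] --> (0 : R).
  apply: cvg_enorm0; rewrite -grad_xs; apply: cvg_comp x_cvg _.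
  exact: differentiable_continuous (f_diff2.2 xs).
have s0 := cvg_sqrt0 g0.
exists (fun k => Num.sqrt (4 / mu *
    (2^-1 * (sigma * Num.sqrt (enorm (grad f (x k)))) + 2 * M * enorm (d k)
     + M * enorm (x k - xs)))); split.
  apply: cvg_sqrt0.
  have -> : (0 : R) = 4 / mu * (2^-1 * (sigma * 0) + 2 * M * 0 + M * 0).
    by rewrite !mulr0 !addr0 mulr0.
  apply: cvgMr; apply: cvgD; last by apply: cvgMr.
  by apply: cvgD; apply: cvgMr => //; apply: cvgMr.
near=> k.
(* Besides the two smallness conditions of the error bound, what has to hold for
   large k is that xs lies in the trust region around x_k. *)
have [sol x_next] := dP k.
rewrite x_next.
apply: (utr_step_error f_diff2 M_gt0 hess_lipschitz grad_xs hess_xs sigma0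
  mu_gt0 sol).
- have ek : 5 * M * enorm (x k - xs) <= mu.
    by near: k; exact: cvg_near_mul_le e0 mu_gt0.
  have := grad_growth f_diff2 M_gt0 hess_lipschitz grad_xs hess_xs ek.
  rewrite -[xs - x k]opprB enormN => grow.
  (* Equivalent to |e_k|^2 <= r^2 (mu / 2) |e_k| after multiplication by
     r^2 |e_k|; the right side is at most the squared radius r^2 |g_k|. *)
  have small : (r ^+ 2)^-1 * enorm (x k - xs) <= mu / 2.
    by near: k; apply: cvg_near_mul_le e0 _; rewrite divr_gt0.
  move: (enorm_ge0 (x k - xs)) (enorm_ge0 (grad f (x k))) grow small.
  move: (enorm (x k - xs)) (enorm (grad f (x k))) => e g e_ge0 g_ge0 grow small.
  rewrite -(ler_pXn2r (ltn0Sn 1)) ?nnegrE ?mulr_ge0 ?sqrtr_ge0 ?(ltW r0)//.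
  rewrite exprMn sqr_sqrtr// -ler_pdivrMl ?exprn_gt0// (le_trans _ grow)//.
  by rewrite expr2 mulrA ler_wpM2r.
- by near: k; exact: cvg_near_mul_le d0 mu_gt0.
- by rewrite -x_next; near: k; exact: cvg_near_mul_le e1 mu_gt0.
Unshelve. all: by end_near. Qed.
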